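(* Let $\{X_i\}_{i=1}^\infty$ be a pseudo-independent sequence of random variables on the sublinear expectation space $(\Omega,\mathcal{F},\mathcal{P})$. Assume that there exist a random variable $X$ on $(\Omega,\mathcal{F},\mathcal{P})$ with $\lim_{n\to\infty}nV(|X|\ge n)=0$ and a constant $K$ such that $V(|X_n|\ge x)\le K\,V(|X|\ge x)$ for each $x\ge0$ and $n\ge1$. Let $S_n=X_1+\cdots+X_n$ and define the real numbers $$\overline{\mu}:=\limsup_{n\to\infty}\frac{\sum_{i=1}^n\mathbb{E}^{\mathcal{P}}[X_i\mathbf{1}_{\{|X_i|<n\}}]}{n},\qquad \underline{\mu}:=\liminf_{n\to\infty}\frac{\sum_{i=1}^n-\mathbb{E}^{\mathcal{P}}[-X_i\mathbf{1}_{\{|X_i|<n\}}]}{n}$$ (both assumed finite). Then for all $\varphi\in C_{b,Lip}(\mathbb{R})$, $$\min_{\underline{\mu}\le\mu\le\overline{\mu}}\varphi(\mu)\le\liminf_{n\to\infty}\mathbb{E}^{\mathcal{P}}\Big[\varphi\Big(\frac{S_n}{n}\Big)\Big]\le\limsup_{n\to\infty}\mathbb{E}^{\mathcal{P}}\Big[\varphi\Big(\frac{S_n}{n}\Big)\Big]\le\max_{\underline{\mu}\le\mu\le\overline{\mu}}\varphi(\mu).$$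
   Context: $\Omega$ is a complete separable metric space, $\mathcal{F}$ its Borel $\sigma$-algebra, and $\mathcal{P}$ is a (nonempty) set of probability measures on $(\Omega,\mathcal{F})$; $(\Omega,\mathcal{F},\mathcal{P})$ is called a sublinear expectation space. For a random variable $X$, $\mathbb{E}^{\mathcal{P}}[X]:=\sup_{P\in\mathcal{P}}E_P[X]$, where $E_P$ is the usual expectation under $P$. For $A\in\mathcal{F}$, $V(A):=\sup_{P\in\mathcal{P}}P(A)$. $C_{b,Lip}(\mathbb{R})$ is the set of bounded Lipschitz functions on $\mathbb{R}$. Pseudo-independence: put $\mathcal{F}_n:=\sigma(X_1,\dots,X_n)$ for $n\ge1$ and $\mathcal{F}_0:=\{\emptyset,\Omega\}$. The sequence $\{X_n\}$ is pseudo-independent if for each $n\ge1$, each $P\in\mathcal{P}$ and each $\varphi\in C_{b,Lip}(\mathbb{R})$, $E_P[\varphi(X_n)\mid\mathcal{F}_{n-1}]\le\mathbb{E}^{\mathcal{P}}[\varphi(X_n)]$ $P$-a.s. *)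

(* Defs.v *)
From HB Require Import structures.
From mathcomp Require Import all_boot all_order all_algebra.
From mathcomp Require Import all_classical all_reals all_analysis.
From mathcomp Require Import measurable_realfun.

Set Implicit Arguments.
Unset Strict Implicit.
Unset Printing Implicit Defensive.

Import Order.TTheory GRing.Theory Num.Theory.
Import numFieldNormedType.Exports.

Local Open Scope classical_set_scope.
Local Open Scope ring_scope.

(* Complete metric spaces.  The library's measurable types are pointed; this
   loses nothing here, since a space carrying a probability is nonempty. *)
#[short(type="completeMetricType")]
HB.structure Definition CompleteMetric (R : numDomainType) :=
  {T of Complete T & Metric R T}.

Definition separable (T : topologicalType) : Prop :=
  exists2 D : set T, countable D & dense D.

Notation borelType T := (g_sigma_algebraType (@open T)).

Section conditional_expectation.
Context d (T : measurableType d) (R : realType).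
Implicit Types (P : probability T R) (G : set (set T)) (Y Z : T -> R).

(* Z is a version of E_P[Y | G]. *)
Definition is_condexp P G Y Z : Prop :=
  [/\ forall B : set R, measurable B -> G (Z @^-1` B),
      P.-integrable [set: T] (EFin \o Z) &
      forall A, G A ->
        (\int[P]_(w in A) (Z w)%:E = \int[P]_(w in A) (Y w)%:E)%E].

Lemma condexp_exists P G Y :
  sigma_algebra [set: T] G -> G `<=` measurable ->
  P.-integrable [set: T] (EFin \o Y) -> exists Z, is_condexp P G Y Z.
Proof.
move=> sG Gm iY.
have GE (A : set (g_sigma_algebraType G)) : measurable A <-> G A.
  by rewrite /measurable/= (sigma_algebra_id sG).
have midG : measurable_fun [set: T] (idfun : T -> (g_sigma_algebraType G)).
  by move=> _ B /GE GB; rewrite setTI; exact: Gm.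
pose iG : {RV P >-> (g_sigma_algebraType G)} := mfun_Sub (mem_set midG).
pose mu : probability (g_sigma_algebraType G) R := distribution P iG.
pose nu_ : {charge set (g_sigma_algebraType G) -> \bar R} :=
  pushforward (induced_charge iY) (idfun : T -> (g_sigma_algebraType G)).
pose nu := nu_ midG.
have numu : nu `<< mu.
  apply/null_content_dominatesP => A /GE /Gm mA muA0.
  change (\int[P]_(w in A) (Y w)%:E = 0)%E.
  apply: null_set_integral => //.
  exact: measurable_funS (measurable_int _ iY).
pose Z0 : (g_sigma_algebraType G) -> \bar R := Radon_Nikodym nu mu.
have iZ0 : mu.-integrable [set: g_sigma_algebraType G] Z0.
  exact: Radon_Nikodym_integrable.
have mZ0 : measurable_fun [set: g_sigma_algebraType G] Z0.
  exact: measurable_int iZ0.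
have fZ0 x : Z0 x \is a fin_num by exact: Radon_Nikodym_fin_num.
have Z0E : EFin \o (fine \o Z0) = Z0 by apply/funext => x /=; rewrite fineK.
have intZ (f : g_sigma_algebraType G -> \bar R)
    (A : set (g_sigma_algebraType G)) : measurable A ->
    measurable_fun [set: g_sigma_algebraType G] f -> (forall x, 0 <= f x)%E ->
    (\int[mu]_(x in A) f x = \int[P]_(x in A) f x)%E.
  move=> mA mf f0; rewrite (@ge0_integral_pushforward _ _ _ _ _ iG)//.
  exact: measurable_funTS.
have mZ : measurable_fun [set: T] (Z0 : T -> \bar R).
  move=> _ B mB; rewrite setTI; apply: Gm; apply/GE.
  by rewrite -[X in measurable X]setTI; exact: mZ0.
have iZ : P.-integrable [set: T] (Z0 : T -> \bar R).
  apply/integrableP; split => //.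
  have /integrableP[_] := iZ0; rewrite intZ//.
  exact: measurableT_comp.
exists (fine \o Z0); split.
- move=> B mB; apply/GE; rewrite -[X in measurable X]setTI.
  by apply: (measurableT_comp _ mZ0) => //; exact: measurable_fine.
- by rewrite Z0E.
- move=> A GA.
  have mA : measurable (A : set (g_sigma_algebraType G)) by exact/GE.
  transitivity (nu A); last by [].
  rewrite (Radon_Nikodym_integral numu mA).
  under eq_integral do rewrite /= fineK//.
  rewrite [RHS](@integral_pushforward _ _ _ _ _ iG)//.
  by apply: (integrableS measurableT) => //; exact: Gm.
Qed.
End conditional_expectation.

Section sublinear_expectation.
Context d (T : measurableType d) (R : realType) (PP : set (probability T R)).
Local Open Scope ereal_scope.

Definition sublinear_expectation (X : T -> R) : \bar R :=
  ereal_sup [set 'E_P[X] | P in PP].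

Definition upper_probability (A : set T) : \bar R :=
  ereal_sup [set P A | P in PP].

End sublinear_expectation.

Definition Cb_Lip (R : realType) : set (R -> R) :=
  [set phi | bounded_fun phi /\ lipschitz phi].

(* Sequences of random variables are indexed from 0: X i stands for X_(i+1).
   Hence X_1, ..., X_n are the X i with i < n and generate the sigma-algebra
   F_n, which is trivial for n = 0, and X n is to be compared with F_n. *)
Section sequences.
Context d (T : measurableType d) (R : realType) (PP : set (probability T R)).
Variable X : nat -> {mfun T >-> R}.

Definition natural_filtration (n : nat) : set (set T) :=
  g_sigma_preimage (fun i : 'I_n => X i : T -> R).

Definition pseudo_independent : Prop :=
  forall (n : nat) (P : probability T R) (phi : R -> R),
    PP P -> Cb_Lip phi ->
    forall Z, is_condexp P (natural_filtration n) (phi \o X n) Z ->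
    {ae P, forall w, (Z w)%:E <= sublinear_expectation PP (phi \o X n)}%E.

Definition partial_sum (n : nat) (w : T) : R := \sum_(i < n) X i w.

(* X_(i+1) 1_{|X_(i+1)| < n} *)
Definition truncated (n i : nat) (w : T) : R :=
  X i w * \1_[set w' | `|X i w'| < n%:R] w.

Local Open Scope ereal_scope.

Definition upper_mean : \bar R :=
  limn_esup (fun n : nat => (n%:R^-1)%:E *
    \sum_(i < n) sublinear_expectation PP (truncated n i)).

Definition lower_mean : \bar R :=
  limn_einf (fun n : nat => (n%:R^-1)%:E *
    \sum_(i < n) - sublinear_expectation PP (\- truncated n i)%R).

End sequences.

Definition is_min (R : realType) (A : set R) (m : R) : Prop :=
  A m /\ lbound A m.
Definition is_max (R : realType) (A : set R) (m : R) : Prop :=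
  A m /\ ubound A m.

(* Main.v *)
Require Import Defs.
From HB Require Import structures.
From mathcomp Require Import all_boot all_order all_algebra.
From mathcomp Require Import all_classical all_reals all_analysis.
From mathcomp Require Import measurable_realfun ring lra zify.

Set Implicit Arguments.
Unset Strict Implicit.
Unset Printing Implicit Defensive.

Import Order.TTheory GRing.Theory Num.Theory.
Import numFieldNormedType.Exports.

Local Open Scope classical_set_scope.
Local Open Scope ring_scope.

(** The law of large numbers holds here for a reason of Chebyshev type, made
    one-sided and uniform over the set [PP] of probabilities.

    Replace each summand by its clamp to [[-n, n]].  The sum is unchanged
    outside the events [|X_i| >= n], whose total probability is at most
    [n * sup_i V(|X_i| >= n)], which tends to 0, and the upper expectations of
    the clamped and of the truncated summands differ by no more than that.
    For clamped summands [Z_i] with upper expectations [u_i], let [D_k] be the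
    positive part of [\sum_(i < k) (Z_i - u_i)].  Then
    [D_(k+1)^2 <= D_k^2 + 2 D_k (Z_k - u_k) + (Z_k - u_k)^2], and by
    pseudo-independence the cross term has expectation at most 0, since [D_k]
    is nonnegative and depends on the past only ([pseudo_independent_weight]).
    Hence the second moment of [D_n] is at most the sum of those of the
    [Z_i - u_i] ([pseudo_independent_excess]).  A layer-cake sum bounds each of
    these by [4 \sum_(k < n) (2k+1) v_k], where [v_k] bounds [V(|X_i| >= k)]
    and [k v_k] tends to 0; by Cesaro this is o(n), so the second moment of
    [D_n] is o(n^2) and [D_n / n] tends to 0 in quadratic mean, uniformly over
    [PP].

    Applied to the clamps and to their opposites, this shows that [S_n / n] is
    close to the interval with end points the averages of the lower and of the
    upper expectations, which ends up in any neighbourhood of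
    [[mu_low, mu_up]].  A Lipschitz function of [S_n / n] is then at most its
    maximum on [[mu_low, mu_up]] up to a small expectation
    ([expectation_mean_le]); the bound from below is the same statement for the
    opposite function. *)

(** * Integration of bounded random variables *)

Section bounded_random_variables.
Context d (T : measurableType d) (R : realType).
Implicit Types (f g : T -> R) (A : set T).

(** Versions of conditional expectations apart, all integrands below are bounded
    and measurable; on these the real-valued integral is linear without any
    discussion of integrability. *)
Definition bounded_rv f :=
  measurable_fun [set: T] f /\ exists M : R, forall x, `|f x| <= M.

Lemma bounded_rv_cst (r : R) : bounded_rv (fun=> r).
Proof. by split; [exact: measurable_cst|exists `|r|]. Qed.

Lemma bounded_rvD f g :
  bounded_rv f -> bounded_rv g -> bounded_rv (fun x => f x + g x).
Proof.
move=> [mf [M fM]] [mg [N gN]]; split; first exact: measurable_funD.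
by exists (M + N) => x; rewrite (le_trans (ler_normD _ _))// lerD.
Qed.

Lemma bounded_rvM f g :
  bounded_rv f -> bounded_rv g -> bounded_rv (fun x => f x * g x).
Proof.
move=> [mf [M fM]] [mg [N gN]]; split; first exact: measurable_funM.
by exists (M * N) => x; rewrite normrM ler_pM.
Qed.

Lemma bounded_rvN f : bounded_rv f -> bounded_rv (fun x => - f x).
Proof.
by move=> [mf [M fM]]; split;
  [exact: measurable_funN|exists M => x; rewrite normrN].
Qed.

Lemma bounded_rvB f g :
  bounded_rv f -> bounded_rv g -> bounded_rv (fun x => f x - g x).
Proof. by move=> bf bg; apply: bounded_rvD => //; exact: bounded_rvN. Qed.

Lemma bounded_rvX f n : bounded_rv f -> bounded_rv (fun x => f x ^+ n).
Proof.
move=> bf; elim: n => [|n ih]; first exact: bounded_rv_cst.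
by under eq_fun do rewrite exprS; exact: bounded_rvM.
Qed.

Lemma bounded_rv_sum n (h : nat -> T -> R) : (forall i, bounded_rv (h i)) ->
  bounded_rv (fun x => \sum_(i < n) h i x).
Proof.
move=> bh; elim: n => [|n ih].
  by under eq_fun do rewrite big_ord0; exact: bounded_rv_cst.
by under eq_fun do rewrite big_ord_recr/=; exact: bounded_rvD.
Qed.

Lemma bounded_rv_pos f : bounded_rv f ->
  bounded_rv (fun x => Num.max (f x) 0).
Proof.
move=> [mf [M fM]]; split; first exact: measurable_maxr.
exists M => x; have := fM x; have [_ //|_ h] := ltP (f x) 0.
by rewrite normr0 => /(le_trans (normr_ge0 _)).
by [].
Qed.

Lemma bounded_rv_indic A : measurable A -> bounded_rv (\1_A : T -> R).
Proof.
move=> mA; split; first exact: measurable_indic.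
by exists 1 => x; rewrite indicE; case: (_ \in _); rewrite ?normr1 ?normr0.
Qed.

Lemma bounded_rv_integrable (P : probability T R) f :
  bounded_rv f -> P.-integrable [set: T] (EFin \o f).
Proof.
move=> [mf [M fM]]; apply: measurable_bounded_integrable => //.
  exact: (le_lt_trans (probability_le1 P measurableT) (ltry 1)).
exists M; split; first exact: num_real.
by by move=> N MN x _; exact: (le_trans (fM x) (ltW MN)).
Qed.

Lemma measurable_normr_ge (f : {mfun T >-> R}) (x : R) :
  measurable [set w | x <= `|f w|].
Proof.
rewrite (_ : [set w | _] = (@Num.norm _ R \o f) @^-1` `[x, +oo[).
  have mf : measurable_fun [set: T] (@Num.norm _ R \o f).
    exact: measurableT_comp.
  by rewrite -[X in measurable X]setTI; exact: mf.
by apply/seteqP; split=> w; rewrite /= in_itv/= andbT.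
Qed.

Section expectation.
Variable P : probability T R.
Local Notation "'EE' f" := (Rintegral P setT f) (at level 10, f at level 9).

Lemma expectationE f : bounded_rv f -> ('E_P[f] = (EE f)%:E)%E.
Proof.
move=> /(bounded_rv_integrable P) iF; rewrite unlock fineK//.
exact: integrable_fin_num.
Qed.

Lemma RintegralDT f g : bounded_rv f -> bounded_rv g ->
  EE (fun x => f x + g x) = EE f + EE g.
Proof. by move=> *; rewrite RintegralD//; exact: bounded_rv_integrable. Qed.

Lemma RintegralZT f r : bounded_rv f -> EE (fun x => r * f x) = r * EE f.
Proof. by move=> *; rewrite RintegralZl//; exact: bounded_rv_integrable. Qed.

Lemma Rintegral_cstT r : EE (fun=> r) = r.
Proof. by rewrite Rintegral_cst//= probability_setT mulr1. Qed.

Lemma RintegralNT f : bounded_rv f -> EE (fun x => - f x) = - EE f.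
Proof.
move=> bf; rewrite -mulN1r -RintegralZT//.
by apply: eq_Rintegral => x _; rewrite mulN1r.
Qed.

Lemma le_RintegralT f g : bounded_rv f -> bounded_rv g ->
  (forall x, f x <= g x) -> EE f <= EE g.
Proof.
by move=> bf bg fg; apply: le_Rintegral => //; exact: bounded_rv_integrable.
Qed.

Lemma Rintegral_sumT n (h : nat -> T -> R) : (forall i, bounded_rv (h i)) ->
  EE (fun x => \sum_(i < n) h i x) = \sum_(i < n) EE (h i).
Proof.
move=> bh; elim: n => [|n ih].
  rewrite big_ord0; under eq_Rintegral do rewrite big_ord0.
  exact: Rintegral_cstT.
rewrite big_ord_recr/= -ih -RintegralDT//; last exact: bounded_rv_sum.
by apply: eq_Rintegral => x _; rewrite big_ord_recr.
Qed.

End expectation.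
End bounded_random_variables.

(** * Real-valued upper expectations *)

Section sublinear_expectation_theory.
Context d (T : measurableType d) (R : realType).
Variables (PP : set (probability T R)) (PP0 : PP !=set0).
Implicit Types (f g : T -> R) (A : set T) (P : probability T R).

Local Notation "''EE_' P f" := (Rintegral P setT f)
  (at level 10, P at level 2, f at level 9).

Definition rsup_expectation f : R := fine (sublinear_expectation PP f).

Lemma sublinear_expectation_le f c : bounded_rv f ->
  (forall P, PP P -> 'EE_P f <= c) -> (sublinear_expectation PP f <= c%:E)%E.
Proof.
move=> bf fc; apply: ge_ereal_sup => _ [P PPP <-].
by rewrite expectationE// lee_fin fc.
Qed.

(** The upper expectation is a real number: a bound on [f] is a bound on its
    expectation under every probability at once, and [PP] is nonempty. *)
Lemma sublinear_expectationE f : bounded_rv f ->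
  sublinear_expectation PP f = (rsup_expectation f)%:E.
Proof.
move=> bf; rewrite fineK// fin_numElt; apply/andP; split.
  have [P PPP] := PP0; apply: (@lt_le_trans _ _ ('EE_P f)%:E).
    exact: ltNyr.
  by apply: ereal_sup_ubound; exists P => //; exact: expectationE.
have [_ [M fM]] := bf; apply: (@le_lt_trans _ _ M%:E); last exact: ltry.
apply: sublinear_expectation_le => // P _; rewrite -[leRHS](Rintegral_cstT P).
apply: le_RintegralT => //; first exact: bounded_rv_cst.
by move=> x; rewrite (le_trans (ler_norm _)).
Qed.

Lemma rsup_expectation_ge f P : bounded_rv f -> PP P ->
  'EE_P f <= rsup_expectation f.
Proof.
move=> bf PPP; rewrite -lee_fin -sublinear_expectationE//.
by apply: ereal_sup_ubound; exists P => //; exact: expectationE.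
Qed.

Lemma rsup_expectation_le f c : bounded_rv f ->
  (forall P, PP P -> 'EE_P f <= c) -> rsup_expectation f <= c.
Proof.
move=> bf fc; rewrite -lee_fin -sublinear_expectationE//.
exact: sublinear_expectation_le.
Qed.

Lemma rsup_expectation_leD f g h : bounded_rv f -> bounded_rv g ->
  bounded_rv h -> (forall x, f x <= g x + h x) ->
  rsup_expectation f <= rsup_expectation g + rsup_expectation h.
Proof.
move=> bf bg bh fgh; apply: rsup_expectation_le => // P PPP.
apply: (@le_trans _ _ ('EE_P g + 'EE_P h)).
  rewrite -RintegralDT//; apply: le_RintegralT => //; exact: bounded_rvD.
by rewrite lerD// rsup_expectation_ge.
Qed.

Definition rupper_probability A : R := rsup_expectation \1_A.

Lemma upper_probabilityE A : measurable A ->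
  upper_probability PP A = (rupper_probability A)%:E.
Proof.
move=> mA; rewrite -sublinear_expectationE; last exact: bounded_rv_indic.
congr ereal_sup; apply/seteqP.
by split=> _ [P PPP <-]; exists P => //; rewrite expectation_indic.
Qed.

End sublinear_expectation_theory.

(** * Bounded Lipschitz test functions *)

Section bounded_lipschitz.
Context (R : realType).
Implicit Types phi : R -> R.

Lemma Cb_LipP phi : Cb_Lip phi <->
  exists M L : R, [/\ 0 <= L, forall x, `|phi x| <= M &
    forall x y, `|phi x - phi y| <= L * `|x - y|].
Proof.
split=> [[[M [_ bM]] [L [_ lL]]]|[M [L [L0 bM lL]]]].
  exists (M + 1), (`|L| + 1); split.
  - by rewrite addr_ge0.
  - by move=> x; apply: bM => //; rewrite ltrDl.
  - move=> x y; apply: (lL (`|L| + 1) _ (x, y)) => //.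
    by rewrite (le_lt_trans (ler_norm _))// ltrDl.
split.
  exists M; split; first exact: num_real.
  by move=> N MN x _; exact: (le_trans (bM x) (ltW MN)).
exists L; split; first exact: num_real.
move=> N LN [x y] _ /=; apply: (le_trans (lL x y)).
by apply: ler_wpM2r => //; exact: ltW.
Qed.

Lemma Cb_Lip_continuous phi : Cb_Lip phi -> continuous phi.
Proof.
move=> /Cb_LipP[M [L [L0 _ lL]]] x; apply/cvgrPdist_le => /= e e0.
near=> y; apply: (le_trans (lL x y)).
apply: (@le_trans _ _ ((L + 1) * `|x - y|)).
  by apply: ler_wpM2r => //; rewrite lerDl.
rewrite mulrC -ler_pdivlMr; last by rewrite ltr_wpDl.
near: y; apply: cvgr_dist_le; last by rewrite divr_gt0// ltr_wpDl.
exact: cvg_id.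
Unshelve. all: by end_near. Qed.

Lemma Cb_Lip_measurable phi : Cb_Lip phi -> measurable_fun [set: R] phi.
Proof. by move=> /Cb_Lip_continuous; exact: continuous_measurable_fun. Qed.

Lemma Cb_LipN phi : Cb_Lip phi -> Cb_Lip (fun x => - phi x).
Proof.
move=> /Cb_LipP[M [L [L0 bM lL]]]; apply/Cb_LipP; exists M, L; split=> //.
  by move=> x; rewrite normrN.
by move=> x y; rewrite -opprD normrN.
Qed.

Lemma bounded_rv_Cb_Lip d (T : measurableType d) phi (f : T -> R) :
  Cb_Lip phi -> measurable_fun [set: T] f -> bounded_rv (phi \o f).
Proof.
move=> phiP mf; split.
  exact: measurableT_comp (Cb_Lip_measurable phiP) mf.
by move: phiP => /Cb_LipP[M [L [_ bM _]]]; exists M => x /=.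
Qed.

End bounded_lipschitz.

(** A nonnegative random variable is thereby a combination with positive
    coefficients of indicators of its own upper level sets, up to one step. *)
Lemma staircase_approx (R : realType) (J : nat) (x : R) : 0 <= x -> x <= J%:R ->
  `|x - \sum_(j < J) (j.+1%:R <= x)%R%:R| <= 1.
Proof.
move=> x0.
suff [] : (x <= J%:R -> `|x - \sum_(j < J) (j.+1%:R <= x)%R%:R| <= 1) /\
  (J%:R <= x -> \sum_(j < J) (j.+1%:R <= x)%R%:R = J%:R :> R) by [].
elim: J => [|J [ih1 ih2]].
  rewrite big_ord0; split => // x0'.
  by rewrite (_ : x = 0) ?subrr ?normr0//; apply/eqP; rewrite eq_le x0 x0'.
rewrite big_ord_recr/=; split => [xJ|Jx].
  have [xJ'|Jx] := leP x J%:R.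
    rewrite (_ : (J.+1%:R <= x) = false) ?addr0; first exact: ih1.
    by apply/negbTE; rewrite -ltNge (le_lt_trans xJ')// ltr_nat.
  rewrite ih2; last exact: ltW.
  have [h|h] := leP J.+1%:R x.
    have -> : x = J.+1%:R by apply/eqP; rewrite eq_le xJ h.
    by rewrite natr1 subrr normr0.
  rewrite addr0 ger0_norm ?subr_ge0; last exact: ltW.
  by rewrite lerBlDl natr1.
by rewrite ih2 ?Jx ?natr1// (le_trans _ Jx)// ler_nat.
Qed.

(** * Pseudo-independence and the one-sided second moment inequality *)

Section pseudo_independence.
Context d (T : measurableType d) (R : realType).
Variables (PP : set (probability T R)) (PP0 : PP !=set0).
Variables (X : nat -> {mfun T >-> R}).
Implicit Types (P : probability T R) (phi : R -> R) (n : nat).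

Local Notation "''EE_' P f" := (Rintegral P setT f)
  (at level 10, P at level 2, f at level 9).

Lemma natural_filtration_preimage n i (B : set R) : (i < n)%N ->
  measurable B -> natural_filtration X n (X i @^-1` B).
Proof.
move=> i_n mB; apply: sub_sigma_algebra.
by rewrite (bigD1 (Ordinal i_n))//=; left; exists B; rewrite ?setTI.
Qed.

Lemma natural_filtration_sub n : natural_filtration X n `<=` measurable.
Proof.
apply: smallest_sub; first exact: sigma_algebra_measurable.
apply: (big_ind (fun C : set (set T) => C `<=` measurable)) => //.
  by move=> C D mC mD A [/mC|/mD].
by move=> i _ _ [B mB <-]; exact: measurable_funPT.
Qed.

(** Functions of the first [n] variables: measurability is taken on the type
    that carries the natural filtration as its sigma-algebra, which makes the
    usual closure properties of measurable functions available. *)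
Definition past_measurable n (f : T -> R) := measurable_fun
  [set: g_sigma_algebraType (natural_filtration X n)]
  (f : g_sigma_algebraType (natural_filtration X n) -> R).

Lemma past_measurableP n f (B : set R) : past_measurable n f -> measurable B ->
  natural_filtration X n (f @^-1` B).
Proof.
move=> mf mB; have := mf measurableT B mB; rewrite setTI.
by rewrite /measurable/= sigma_algebra_id//; exact: smallest_sigma_algebra.
Qed.

Lemma past_measurable_comp n i phi : (i < n)%N -> measurable_fun [set: R] phi ->
  past_measurable n (phi \o X i).
Proof.
move=> i_n mphi _ B mB; rewrite setTI; apply: sub_sigma_algebra.
rewrite comp_preimage; apply: natural_filtration_preimage => //.
by rewrite -[X in measurable X]setTI; exact: mphi.
Qed.

Hypothesis indX : pseudo_independent PP X.

Local Notation u n phi := (rsup_expectation PP (phi \o X n)).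

(** Integrating over [A] the almost sure bound on a version of the conditional
    expectation; this turns pseudo-independence into a statement that mentions
    integrals only. *)
Lemma pseudo_independent_event P n phi A : PP P -> Cb_Lip phi ->
  natural_filtration X n A ->
  'EE_P (fun w => \1_A w * (phi (X n w) - u n phi)) <= 0.
Proof.
move=> PPP phiP FA.
have bphi : bounded_rv (phi \o X n) by exact: bounded_rv_Cb_Lip.
have mA : measurable A by exact: natural_filtration_sub FA.
have [Z ZP] : exists Z, is_condexp P (natural_filtration X n) (phi \o X n) Z.
  apply: condexp_exists; first exact: smallest_sigma_algebra.
    exact: natural_filtration_sub.
  exact: bounded_rv_integrable.
have Zle := indX PPP phiP ZP.
move: ZP => [FZ iZ ZE].
have mZ : measurable_fun [set: T] Z.
  by move=> _ B mB; rewrite setTI; apply: natural_filtration_sub; exact: FZ.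
have iZA : P.-integrable A (EFin \o Z).
  by apply: integrableS iZ.
have icA c : P.-integrable A (EFin \o cst c).
  apply: (integrableS measurableT) => //.
  exact: bounded_rv_integrable (bounded_rv_cst _ c).
have ZA : (\int[P]_(w in A) (Z w)%:E <= \int[P]_(w in A) (u n phi)%:E)%E.
  have mZA : measurable_fun A (EFin \o Z) by exact: measurable_int iZA.
  (* [Z] agrees almost everywhere with its minimum with the bound, which is
     below the bound everywhere. *)
  have mZu : measurable_fun A (fun w => (Num.min (Z w) (u n phi))%:E).
    apply/measurable_EFinP; apply: measurable_minr => //.
    exact: measurable_funTS.
  rewrite (@ae_eq_integral _ _ _ P A (fun w => (Num.min (Z w) (u n phi))%:E))//.
    apply: le_integral => //.
      apply: (le_integrable mA _ _ (integrableD mA (integrable_abse iZA)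
        (integrable_abse (icA (u n phi))))) => //.
      move=> w _ /=; rewrite lee_fin [leRHS]ger0_norm ?addr_ge0//.
      by have [_|_] := leP (Z w) (u n phi); rewrite ?lerDl ?lerDr.
      exact: icA.
    by move=> w _; rewrite lee_fin ge_min lexx orbT.
  apply: filterS Zle => w; rewrite (sublinear_expectationE PP0)// lee_fin.
  by move=> h _; congr EFin; rewrite min_l.
have E1 : 'EE_P (fun w => \1_A w * (phi (X n w) - u n phi)) =
    \int[P]_(w in A) phi (X n w) - \int[P]_(w in A) u n phi.
  rewrite -RintegralB//; last 2 first.
  - by apply: (integrableS measurableT) => //; exact: bounded_rv_integrable bphi.
  - exact: icA.
  rewrite [RHS]Rintegral_mkcond; apply: eq_Rintegral => w _.
  by rewrite /patch indicE; case: (w \in A); rewrite ?mul1r ?mul0r.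
rewrite E1 subr_le0 /Rintegral -(ZE _ FA).
apply: fine_le => //; first exact: (integrable_fin_num mA iZA).
exact: (integrable_fin_num mA (icA _)).
Qed.

(** The weight [W] is approximated to within [dl] by a staircase in its upper
    level sets [W >= (j + 1) dl], which are events of the past; the inequality
    for events applies to each step, and [dl] is arbitrary. *)
Lemma pseudo_independent_weight P n phi (W : T -> R) : PP P -> Cb_Lip phi ->
  past_measurable n W -> bounded_rv W -> (forall w, 0 <= W w) ->
  'EE_P (fun w => W w * (phi (X n w) - u n phi)) <= 0.
Proof.
move=> PPP phiP pW bW W0; set h := fun w => phi (X n w) - u n phi.
have bh : bounded_rv h.
  by apply: bounded_rvB (bounded_rv_cst _ _); exact: bounded_rv_Cb_Lip.
have [_ [H hH]] := bh; have [_ [M WM]] := bW.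
have H0 : 0 <= H by rewrite (le_trans _ (hH point)).
suff hdelta dl : 0 < dl -> 'EE_P (fun w => W w * h w) <= dl * H.
  rewrite leNgt; apply/negP => h0.
  have dl0 : 0 < 'EE_P (fun w => W w * h w) / (H + 1) / 2.
    by rewrite !divr_gt0// ltr_wpDl.
  have := hdelta _ dl0; rewrite leNgt => /negP; apply.
  rewrite -!mulrA gtr_pMr// ltr_pdivrMl ?ltr_wpDl//.
  by move: H0; lra.
move=> dl0; pose J := (Num.truncn (M / dl)).+1.
have WJ w : W w / dl <= J%:R.
  apply: (@le_trans _ _ (M / dl)); last exact/ltW/truncnS_gt.
  by rewrite ler_pM2r ?invr_gt0// (le_trans (ler_norm _)).
pose A (j : nat) := [set w | j.+1%:R <= W w / dl].
have FA j : natural_filtration X n (A j).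
  rewrite (_ : A j = W @^-1` `[j.+1%:R * dl, +oo[); first exact: past_measurableP.
  by apply/seteqP; split=> w; rewrite /A/= in_itv/= andbT ler_pdivlMr.
have mA j : measurable (A j) by exact: natural_filtration_sub (FA j).
pose Wd w := dl * \sum_(j < J) \1_(A j) w.
have bAh j : bounded_rv (fun w => \1_(A j) w * h w).
  by apply: bounded_rvM => //; exact: bounded_rv_indic.
have bWd : bounded_rv Wd.
  apply: bounded_rvM (bounded_rv_cst _ _) _.
  apply: (@bounded_rv_sum _ _ _ _ (fun j => \1_(A j))) => j.
  exact: bounded_rv_indic.
have WWd w : `|W w - Wd w| <= dl.
  have Wdl0 : 0 <= W w / dl by rewrite divr_ge0// ltW.
  have := staircase_approx Wdl0 (WJ w).
  rewrite -(ler_pM2l dl0) mulr1 -{1}(gtr0_norm dl0) -normrM.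
  rewrite mulrBr mulrCA divff ?gt_eqF// mulr1; congr (`|_ - _ * _| <= _).
  apply: eq_bigr => j _; rewrite indicE.
  by have [Ajw|/negP Ajw] := boolP (_ <= _); [rewrite mem_set|rewrite memNset].
apply: (@le_trans _ _ ('EE_P (fun w => Wd w * h w + dl * H))).
  apply: le_RintegralT => //; first exact: bounded_rvM.
    by apply: bounded_rvD (bounded_rv_cst _ _); exact: bounded_rvM.
  move=> w; rewrite -lerBlDl -mulrBl (le_trans (ler_norm _))// normrM.
  exact: ler_pM.
rewrite RintegralDT ?Rintegral_cstT; last exact: bounded_rv_cst.
  2: exact: bounded_rvM.
rewrite gerDr; under eq_Rintegral do rewrite -mulrA mulr_suml.
rewrite RintegralZT; last first.
  exact: (@bounded_rv_sum _ _ _ _ (fun j w => \1_(A j) w * h w)).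
rewrite (@Rintegral_sumT _ _ _ _ _ (fun j w => \1_(A j) w * h w))//.
rewrite pmulr_rle0//; apply: sumr_le0 => j _; exact: pseudo_independent_event.
Qed.

(** Only an upper bound on conditional expectations is available, so the
    orthogonality of martingale increments has to be replaced by an inequality.
    Taking positive parts gives the past sum the sign that this needs:
    [(a + b)^+ <= |a^+ + b|], and in the square of the right-hand side the cross
    term [a^+ * b] has expectation at most 0. *)
Lemma pseudo_independent_excess P n (g : nat -> R -> R) : PP P ->
  (forall i, Cb_Lip (g i)) ->
  'EE_P (fun w =>
    Num.max (\sum_(i < n) (g i (X i w) - u i (g i))) 0 ^+ 2) <=
  \sum_(i < n) 'EE_P (fun w => (g i (X i w) - u i (g i)) ^+ 2).
Proof.
move=> PPP gP; pose h i w := g i (X i w) - u i (g i).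
have bh i : bounded_rv (h i).
  by apply: bounded_rvB (bounded_rv_cst _ _); exact: bounded_rv_Cb_Lip.
pose D k w := Num.max (\sum_(i < k) h i w) 0.
have bD k : bounded_rv (D k) by apply: bounded_rv_pos; exact: bounded_rv_sum.
have D0 k w : 0 <= D k w by rewrite le_max lexx orbT.
rewrite -/(D n); elim: n => [|n ih].
  rewrite big_ord0 (_ : (fun w => _) = fun=> 0) ?Rintegral_cstT//.
  by apply/funext => w; rewrite big_ord0 maxxx expr0n.
rewrite big_ord_recr/=; apply: le_trans (lerD ih (lexx _)).
rewrite -RintegralDT; [|exact: bounded_rvX (bD n)|exact: bounded_rvX (bh n)].
have bDh : bounded_rv (fun w => D n w * h n w) by exact: bounded_rvM.
have bsq : bounded_rv (fun w => D n w ^+ 2 + h n w ^+ 2).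
  by apply: bounded_rvD; apply: bounded_rvX.
have b2Dh : bounded_rv (fun w => 2 * (D n w * h n w)).
  exact: (bounded_rvM (bounded_rv_cst T (2 : R)) bDh).
apply: (@le_trans _ _
    ('EE_P (fun w => D n w ^+ 2 + h n w ^+ 2 + 2 * (D n w * h n w)))).
  apply: le_RintegralT.
  - exact: bounded_rvX (bD n.+1).
  - exact: bounded_rvD.
  move=> w; rewrite [leRHS](_ : _ = (D n w + h n w) ^+ 2); last by ring.
  have Dh : D n.+1 w <= `|D n w + h n w|.
    rewrite ge_max normr_ge0 andbT (le_trans _ (ler_norm _))// big_ord_recr/=.
    by rewrite lerD2r le_max lexx.
  by rewrite -[leRHS]real_normK ?num_real//; apply: lerXn2r => //; exact: D0.
rewrite (RintegralDT P bsq b2Dh) gerDl RintegralZT// pmulr_rle0//.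
apply: pseudo_independent_weight => //.
apply: measurable_maxr => //.
have m_h i : (i < n)%N -> past_measurable n (h i).
  move=> i_n; apply: measurable_funB => //.
  exact: past_measurable_comp (Cb_Lip_measurable (gP i)).
rewrite (_ : (fun w => _) = fun w => \sum_(i <- enum 'I_n) h i w); last first.
  by apply/funext => w; rewrite big_enum.
by apply: measurable_sum => i; exact: m_h.
Qed.

End pseudo_independence.

(** * Clamping and second moments *)

Section clamp.
Context (R : realType).
Implicit Types x y : R.

(** Truncation at level [n] is not continuous, while pseudo-independence is about
    Lipschitz functions; clamping is Lipschitz and differs from truncation only
    where [|x| >= n]. *)
Definition clamp (n : nat) x : R := Num.max (- n%:R) (Num.min x n%:R).

Lemma clampN n x : clamp n (- x) = - clamp n x.
Proof.
have nn : - n%:R <= n%:R :> R by rewrite (@le_trans _ _ 0)// oppr_le0.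
rewrite /clamp oppr_max opprK oppr_min max_minr (max_r nn) minC.
by rewrite [Num.max (- x) _]maxC.
Qed.

Lemma clamp_id n x : `|x| < n%:R -> clamp n x = x.
Proof.
rewrite ltr_norml => /andP[h1 h2].
by rewrite /clamp min_l ?ltW// max_r// ltW.
Qed.

Lemma normr_clamp n x : `|clamp n x| = Num.min `|x| n%:R.
Proof.
have n0 : (0 : R) <= n%:R by [].
have [xn|nx] := ltP `|x| n%:R; first by rewrite clamp_id.
wlog x0 : x nx / 0 <= x.
  move=> h; have [x0|x0] := leP 0 x; first exact: h.
  by rewrite -normrN -clampN h ?normrN// oppr_ge0 ltW.
rewrite ger0_norm// in nx.
rewrite /clamp min_r// max_r ?ger0_norm//.
by rewrite (le_trans _ n0)// oppr_le0.
Qed.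

Lemma clamp_lip n x y : `|clamp n x - clamp n y| <= `|x - y|.
Proof.
wlog xy : x y / x <= y.
  by move=> h; have /orP[/h//|/h] := le_total x y; rewrite distrC [leRHS]distrC.
have le_xy : clamp n x <= clamp n y.
  rewrite /clamp ge_max !le_max lexx/=; apply/orP; right.
  by rewrite le_min !ge_min xy lexx !orbT.
rewrite distrC [leRHS]distrC !ger0_norm ?subr_ge0// lerBlDr.
have yx0 : 0 <= y - x by rewrite subr_ge0.
rewrite {1}/clamp ge_max; apply/andP; split.
  by rewrite (@le_trans _ _ (clamp n x))// ?lerDr// le_max lexx.
rewrite (@le_trans _ _ (y - x + Num.min x n%:R))//; last first.
  by rewrite lerD2l /clamp le_max lexx orbT.
by rewrite addr_minr subrK le_min !ge_min lexx lerDr yx0 orbT.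
Qed.

Lemma Cb_Lip_clamp n : Cb_Lip (clamp n).
Proof.
apply/Cb_LipP; exists n%:R, 1; split => //.
- by move=> x; rewrite normr_clamp ge_min lexx orbT.
- by move=> x y; rewrite mul1r clamp_lip.
Qed.

(** Layer-cake bound: [2k + 1] is the increment from [k^2] to [(k+1)^2], so the
    second moment of a clamped variable is controlled by its tails at integers. *)
Lemma clamp_sqr_le n x :
  clamp n x ^+ 2 <= \sum_(k < n) (k.*2.+1)%:R * (k%:R <= `|x|)%R%:R.
Proof.
rewrite -real_normK ?num_real// normr_clamp.
elim: n => [|n ih]; first by rewrite big_ord0 min_r ?normr_ge0// expr0n.
rewrite big_ord_recr/=; apply: le_trans (lerD ih (lexx _)).
have [nx|xn] := leP n%:R `|x|; last first.
  by rewrite mulr0 addr0 min_l// ltW// (lt_trans xn)// ltr_nat.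
rewrite mulr1; apply: (@le_trans _ _ (n.+1%:R ^+ 2)).
  by apply: lerXn2r; rewrite ?nnegrE ?le_min ?ge_min ?lexx ?orbT ?normr_ge0//= ler0n.
by rewrite -!natrX -natrD ler_nat; lia.
Qed.

Lemma clamp_truncation n x :
  `|clamp n x - x * (`|x| < n%:R)%R%:R| <= n%:R * (n%:R <= `|x|)%R%:R.
Proof.
have [nx|xn] := leP n%:R `|x|.
  by rewrite mulr0 subr0 mulr1 normr_clamp ge_min lexx orbT.
by rewrite mulr1 mulr0 clamp_id// subrr normr0.
Qed.

End clamp.

Section second_moment.
Context d (T : measurableType d) (R : realType).
Variables (PP : set (probability T R)) (PP0 : PP !=set0).
Local Notation "''EE_' P f" := (Rintegral P setT f)
  (at level 10, P at level 2, f at level 9).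

(** For a single probability this is Jensen's inequality.  The supremum [u] need
    not be attained, so the bound [2 u E[f] <= u^2 + E[f^2]] is used for every
    probability, with [u] itself as the constant, before passing to the
    supremum.  The case [u < 0] needs one probability only, as then
    [E[f] <= u < 0]. *)
Lemma rsup_expectation_sqr_le (f : T -> R) (s : R) : bounded_rv f ->
  (forall P, PP P -> 'EE_P (fun w => f w ^+ 2) <= s) ->
  rsup_expectation PP f ^+ 2 <= s.
Proof.
move=> bf fs; set u := rsup_expectation PP f.
have young P : PP P -> 2 * u * 'EE_P f <= u ^+ 2 + s.
  move=> PPP; rewrite -RintegralZT//.
  apply: (@le_trans _ _ ('EE_P (fun w => u ^+ 2 + f w ^+ 2))).
    apply: le_RintegralT.
    - exact: bounded_rvM (bounded_rv_cst _ _) bf.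
    - apply: bounded_rvD; [exact: bounded_rv_cst|exact: bounded_rvX].
    by move=> w; rewrite -subr_ge0 (_ : _ - _ = (u - f w) ^+ 2) ?sqr_ge0//; ring.
  rewrite RintegralDT ?Rintegral_cstT;
    [|exact: bounded_rv_cst|exact: bounded_rvX].
  by rewrite lerD2l fs.
have [u0|u0|u0] := ltgtP u 0.
- have [P PPP] := PP0; have := young P PPP.
  have : u ^+ 2 <= u * 'EE_P f.
    by rewrite expr2 ler_nM2l// rsup_expectation_ge.
  by rewrite -mulrA; lra.
- suff : u <= (u ^+ 2 + s) / (2 * u).
    rewrite ler_pdivlMr ?mulr_gt0// -subr_ge0 => us0; rewrite -subr_ge0.
    by move: us0; congr (_ <= _); ring.
  apply: rsup_expectation_le => // P PPP.
  by rewrite ler_pdivlMr ?mulr_gt0// mulrC young.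
- rewrite u0 expr0n/=; have [P PPP] := PP0; apply: le_trans (fs P PPP).
  by apply: Rintegral_ge0 => w _; exact: sqr_ge0.
Qed.

Lemma centered_second_moment_le (f : T -> R) (s : R) P : bounded_rv f ->
  (forall P, PP P -> 'EE_P (fun w => f w ^+ 2) <= s) -> PP P ->
  'EE_P (fun w => (f w - rsup_expectation PP f) ^+ 2) <= 4 * s.
Proof.
move=> bf fs PPP; have := rsup_expectation_sqr_le bf fs.
set u := rsup_expectation PP f => us.
have bf2 : bounded_rv (fun w => 2 * f w ^+ 2).
  by apply: bounded_rvM; [exact: bounded_rv_cst|exact: bounded_rvX].
apply: (@le_trans _ _ ('EE_P (fun w => 2 * f w ^+ 2 + 2 * u ^+ 2))).
  apply: le_RintegralT.
  - by apply: bounded_rvX; apply: bounded_rvB => //; exact: bounded_rv_cst.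
  - by apply: bounded_rvD => //; exact: bounded_rv_cst.
  by move=> w; rewrite -subr_ge0 (_ : _ - _ = (f w + u) ^+ 2) ?sqr_ge0//; ring.
rewrite RintegralDT ?Rintegral_cstT//; last exact: bounded_rv_cst.
rewrite RintegralZT; last exact: bounded_rvX.
have := fs P PPP; lra.
Qed.

End second_moment.

(** * Limits and deterministic estimates *)

Section limits.
Context (R : realType).

Lemma limn_esup_near (u : (\bar R)^nat) (c : \bar R) : (limn_esup u < c)%E ->
  \forall n \near \oo, (u n < c)%E.
Proof.
move=> /ereal_inf_lt[_ [V nV <-] Vc]; apply: filterS nV => n Vn.
by apply: le_lt_trans Vc; apply: ereal_sup_ubound; exists n.
Qed.

Lemma limn_esup_le_near (u : (\bar R)^nat) (c : R) :
  (forall e : R, 0 < e -> \forall n \near \oo, (u n <= (c + e)%:E)%E) ->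
  (limn_esup u <= c%:E)%E.
Proof.
move=> uc; apply/lee_addgt0Pr => e e0; rewrite -EFinD.
apply: (@le_trans _ _ (ereal_sup (u @` [set n | (u n <= (c + e)%:E)%E]))).
  apply: ereal_inf_lbound.
  by exists [set n | (u n <= (c + e)%:E)%E] => //; exact: uc.
by apply: ge_ereal_sup => _ [n un <-].
Qed.

(** The summands tend to 0, so the statement is Cesaro's. *)
Lemma second_moment_average_cvg0 (v : nat -> R) :
  (fun n : nat => n%:R * v n) @ \oo --> (0 : R) ->
  (fun n : nat => (\sum_(k < n) (k.*2.+1)%:R * v k) / n%:R) @ \oo --> (0 : R).
Proof.
move=> nv0; have v0 : v @ \oo --> (0 : R).
  apply/cvgrPdist_le => e e0.
  have /cvgrPdist_le/(_ _ e0) nve := nv0; near=> n.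
  have n1 : (1 <= n)%N by near: n; exact: nbhs_infty_ge.
  apply: (@le_trans _ _ `|0 - n%:R * v n|); last by near: n.
  rewrite !sub0r !normrN normrM ger0_norm// ler_peMl// ler1n.
  exact: n1.
have w0 : (fun k => (k.*2.+1)%:R * v k) @ \oo --> (0 : R).
  rewrite (_ : (fun k => _) = fun k => 2 * (k%:R * v k) + v k); last first.
    by apply/funext => k; rewrite -natr1 -mul2n natrM; ring.
  rewrite -[0](addr0 0) -[X in X + _](mulr0 2).
  by apply: cvgD v0; apply: cvgMr.
set f := (fun n : nat => _ / _); rewrite -(cvg_shiftS f).
rewrite (_ : (fun n => f n.+1) = arithmetic_mean (fun k => (k.*2.+1)%:R * v k)).
  exact: cesaro w0.
by apply/funext => n; rewrite /f /arithmetic_mean/= /series/= big_mkord mulrC.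
Unshelve. all: by end_near. Qed.

End limits.

Lemma average_leD (R : realFieldType) n (a b : nat -> R) (x : R) : (0 < n)%N ->
  (forall i, a i <= b i + x) ->
  (\sum_(i < n) a i) / n%:R <= n%:R^-1 * (\sum_(i < n) b i) + x.
Proof.
move=> n0 abx; have nR0 : 0 < n%:R :> R by rewrite ltr0n.
rewrite ler_pdivrMr// mulrDl mulrAC mulVf ?gt_eqF// mul1r.
rewrite -[X in _ + X * _](mulr1 x) -mulrA mul1r mulr_natr -[X in _ *+ X]card_ord.
by rewrite -sumr_const -big_split; apply: ler_sum => i _; exact: abx.
Qed.

(** Compare [y] with the nearest point of the interval. *)
Lemma lipschitz_le_near_interval (R : realFieldType) (phi : R -> R)
    (M L lo up y a b : R) :
  lo <= up -> (forall x, lo <= x <= up -> phi x <= M) -> 0 <= L ->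
  (forall x x', `|phi x - phi x'| <= L * `|x - x'|) ->
  0 <= a -> 0 <= b -> y <= up + a -> lo - b <= y ->
  phi y <= M + L * (a + b).
Proof.
move=> loup phiM L0 lL a0 b0 ya yb.
suff [p /phiM pM yp] : exists2 p, lo <= p <= up & `|y - p| <= a + b.
  rewrite -lerBlDl (le_trans (lerB (lexx (phi y)) pM))//.
  rewrite (le_trans (ler_norm _))// (le_trans (lL _ _))//.
  exact: ler_wpM2l.
have [ylo|loy] := ltP y lo.
  exists lo; first by rewrite lexx.
  by rewrite ltr0_norm ?subr_lt0// opprB; lra.
have [upy|yup] := ltP up y.
  exists up; first by rewrite loup lexx.
  by rewrite gtr0_norm ?subr_gt0//; lra.
by exists y; [rewrite loy|rewrite subrr normr0 addr_ge0].
Qed.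

(** * The law of large numbers *)

Section law_of_large_numbers.
Context d (T : measurableType d) (R : realType).
Variables (PP : set (probability T R)) (PP0 : PP !=set0).
Variables (X : nat -> {mfun T >-> R}).
Hypothesis indX : pseudo_independent PP X.
Variable v : nat -> R.
Hypothesis tail_le : forall i k,
  rupper_probability PP [set w | k%:R <= `|X i w|] <= v k.
Hypothesis nv0 : (fun n : nat => n%:R * v n) @ \oo --> (0 : R).

Local Notation "''EE_' P f" := (Rintegral P setT f)
  (at level 10, P at level 2, f at level 9).
Local Notation V := (rupper_probability PP).
Local Notation rsup := (rsup_expectation PP).
Let tail i k : set T := [set w | k%:R <= `|X i w|].
Let s n := \sum_(k < n) (k.*2.+1)%:R * v k.

Let bounded_tail i k : bounded_rv (\1_(tail i k) : T -> R).
Proof. by apply: bounded_rv_indic; exact: measurable_normr_ge. Qed.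

Let tailE i k w : (\1_(tail i k) w : R) = (k%:R <= `|X i w|)%R%:R.
Proof.
rewrite indicE.
by have [h|/negP h] := boolP (_ <= _); [rewrite mem_set|rewrite memNset].
Qed.

Let E_tail_le P i k : PP P -> 'EE_P \1_(tail i k) <= v k.
Proof. by move=> PPP; apply: le_trans (tail_le i k); exact: rsup_expectation_ge. Qed.

Let bounded_clamp (n i : nat) : bounded_rv (clamp n \o X i).
Proof. by apply: bounded_rv_Cb_Lip => //; exact: Cb_Lip_clamp. Qed.

Lemma clamp_second_moment_le P n i : PP P ->
  'EE_P (fun w => clamp n (X i w) ^+ 2) <= s n.
Proof.
move=> PPP; apply: (@le_trans _ _
    ('EE_P (fun w => \sum_(k < n) (k.*2.+1)%:R * \1_(tail i k) w))).
  apply: le_RintegralT.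
  - exact: bounded_rvX (bounded_clamp n i).
  - apply: (@bounded_rv_sum _ _ _ _
      (fun k w => (k.*2.+1)%:R * \1_(tail i k) w)) => k.
    exact: bounded_rvM (bounded_rv_cst _ _) _.
  move=> w; rewrite (le_trans (clamp_sqr_le n (X i w)))//.
  by apply: ler_sum => k _; rewrite tailE.
rewrite (@Rintegral_sumT _ _ _ _ _ (fun k w => (k.*2.+1)%:R * \1_(tail i k) w)).
  by apply: ler_sum => k _; rewrite RintegralZT// ler_wpM2l// E_tail_le.
by move=> k; exact: bounded_rvM (bounded_rv_cst _ _) _.
Qed.

(** The first moment is obtained from the second by [y <= e + y^2 / e], which
    avoids square roots.  The function [g] stands for the clamp and for its
    opposite, which have the same square. *)
Lemma mean_excess_le P n (g : R -> R) (e : R) : PP P -> Cb_Lip g ->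
  (forall x, g x ^+ 2 = clamp n x ^+ 2) -> (0 < n)%N -> 0 < e ->
  'EE_P (fun w =>
      Num.max (\sum_(i < n) (g (X i w) - rsup (g \o X i))) 0 / n%:R) <=
    e + 4 * (s n / n%:R) / e.
Proof.
move=> PPP gP g2 n0 e0.
pose D w := Num.max (\sum_(i < n) (g (X i w) - rsup (g \o X i))) 0.
have nR0 : 0 < n%:R :> R by rewrite ltr0n.
have bg i : bounded_rv (g \o X i) by exact: bounded_rv_Cb_Lip.
have bD : bounded_rv D.
  apply: bounded_rv_pos; apply: (@bounded_rv_sum _ _ _ _
    (fun i w => g (X i w) - rsup (g \o X i))) => i.
  by apply: bounded_rvB (bounded_rv_cst _ _); exact: bg.
have bD2 : bounded_rv (fun w => (n%:R ^+ 2 * e)^-1 * D w ^+ 2).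
  by apply: bounded_rvM; [exact: bounded_rv_cst|exact: bounded_rvX].
apply: (@le_trans _ _ ('EE_P (fun w => e + (n%:R ^+ 2 * e)^-1 * D w ^+ 2))).
  apply: le_RintegralT.
  - by apply: bounded_rvM => //; exact: bounded_rv_cst.
  - by apply: bounded_rvD => //; exact: bounded_rv_cst.
  move=> w; set y := D w / n%:R.
  have -> : (n%:R ^+ 2 * e)^-1 * D w ^+ 2 = y ^+ 2 / e.
    by rewrite /y; field; rewrite !gt_eqF.
  rewrite -lerBlDl ler_pdivlMr// -subr_ge0.
  have -> : y ^+ 2 - (y - e) * e = (y - e / 2) ^+ 2 + 3 * (e / 2) ^+ 2 by field.
  by rewrite addr_ge0 ?sqr_ge0// mulr_ge0 ?sqr_ge0.
rewrite RintegralDT//; last exact: bounded_rv_cst.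
rewrite Rintegral_cstT lerD2l RintegralZT; last exact: bounded_rvX.
have ED : 'EE_P (fun w => D w ^+ 2) <= n%:R * (4 * s n).
  apply: (le_trans (pseudo_independent_excess PP0 indX n PPP (fun=> gP))).
  rewrite (@le_trans _ _ (\sum_(i < n) 4 * s n))//; last first.
    by rewrite sumr_const card_ord [leRHS]mulr_natl.
  apply: ler_sum => i _.
  apply: (centered_second_moment_le PP0 (bg i)) => // Q PPQ /=.
  under eq_Rintegral do rewrite g2.
  exact: clamp_second_moment_le.
have -> : 4 * (s n / n%:R) / e = (n%:R ^+ 2 * e)^-1 * (n%:R * (4 * s n)).
  by field; rewrite !gt_eqF.
by rewrite ler_pM2l// invr_gt0 mulr_gt0// exprn_gt0.
Qed.

Lemma bounded_truncated n i : bounded_rv (truncated X n i).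
Proof.
have mA : measurable [set w | `|X i w| < n%:R].
  rewrite (_ : [set w | _] = ~` tail i n).
    by apply: measurableC; exact: measurable_normr_ge.
  by apply/seteqP; split=> w; rewrite /tail/= ltNge => /negP.
split.
  by apply: measurable_funM => //; exact: measurable_indic.
exists n%:R => w; rewrite /truncated indicE.
have [Xn|Xn] := boolP (`|X i w| < n%:R).
  by rewrite mem_set// mulr1 ltW.
by rewrite memNset ?mulr0 ?normr0//; exact/negP.
Qed.

Let truncated_indic n i w :
  truncated X n i w = X i w * (`|X i w| < n%:R)%R%:R.
Proof.
rewrite /truncated indicE.
by have [h|/negP h] := boolP (_ < _); [rewrite mem_set|rewrite memNset].
Qed.

Let rsup_tail_le n i : rsup (fun w => n%:R * \1_(tail i n) w) <= n%:R * v n.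
Proof.
apply: rsup_expectation_le => //; first exact: bounded_rvM (bounded_rv_cst _ _) _.
by move=> P PPP; rewrite RintegralZT// ler_wpM2l// E_tail_le.
Qed.

(** The means of the theorem are those of the truncated variables, whereas the
    argument above is about clamped ones; this lemma and the next compare them. *)
Lemma clamped_mean_le n i : rsup (clamp n \o X i) <=
  rsup (truncated X n i) + n%:R * v n.
Proof.
apply: le_trans (lerD (lexx _) (rsup_tail_le n i)).
apply: rsup_expectation_leD => //.
- exact: bounded_truncated.
- exact: bounded_rvM (bounded_rv_cst _ _) _.
move=> w /=; rewrite truncated_indic tailE -lerBlDl.
exact: le_trans (ler_norm _) (clamp_truncation _ _).
Qed.

Lemma clamped_meanN_le n i : rsup ((fun x => - clamp n x) \o X i) <=
  rsup (\- truncated X n i) + n%:R * v n.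
Proof.
apply: le_trans (lerD (lexx _) (rsup_tail_le n i)).
apply: rsup_expectation_leD => //.
- exact: bounded_rvN (bounded_clamp n i).
- exact: bounded_rvN (bounded_truncated n i).
- exact: bounded_rvM (bounded_rv_cst _ _) _.
move=> w /=; rewrite truncated_indic tailE -lerBlDl.
rewrite opprK addrC.
apply: le_trans (ler_norm _) _; rewrite -normrN opprB.
exact: clamp_truncation.
Qed.

Variables mu_low mu_up : R.
Hypothesis mean_up : forall e : R, 0 < e -> \forall n \near \oo,
  n%:R^-1 * \sum_(i < n) rsup (truncated X n i) <= mu_up + e.
Hypothesis mean_low : forall e : R, 0 < e -> \forall n \near \oo,
  n%:R^-1 * \sum_(i < n) rsup (\- truncated X n i) <= - mu_low + e.

(** Since [f] and [- f] cancel under each probability, their upper expectations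
    have a nonnegative sum. *)
Lemma mean_low_le_up : mu_low <= mu_up.
Proof.
apply/ler_addgt0Pr => e e0; have e20 : 0 < e / 2 by rewrite divr_gt0.
near \oo => n.
have up : n%:R^-1 * \sum_(i < n) rsup (truncated X n i) <= mu_up + e / 2.
  by near: n; exact: mean_up.
have low : n%:R^-1 * \sum_(i < n) rsup (\- truncated X n i) <= - mu_low + e / 2.
  by near: n; exact: mean_low.
have : 0 <= n%:R^-1 * \sum_(i < n) rsup (truncated X n i) +
            n%:R^-1 * \sum_(i < n) rsup (\- truncated X n i).
  rewrite -mulrDr -big_split/= mulr_ge0 ?invr_ge0//.
  apply: sumr_ge0 => i _; have [P PPP] := PP0; have bt := bounded_truncated n i.
  have := lerD (rsup_expectation_ge PP0 bt PPP)
               (rsup_expectation_ge PP0 (bounded_rvN bt) PPP).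
  by rewrite RintegralNT// subrr.
by move: up low; lra.
Unshelve. all: by end_near. Qed.

(** Three errors are to be absorbed in [e], uniformly over [PP]: the event that
    some variable exceeds the clamping level, where [phi] is only known to be
    bounded by [B]; the distance from the averaged upper expectations to
    [[mu_low, mu_up]]; and the excesses [Dp] and [Dm] of the average over these. *)
Lemma expectation_mean_le (phi : R -> R) (M e : R) : Cb_Lip phi ->
  (forall x, mu_low <= x <= mu_up -> phi x <= M) -> 0 < e ->
  \forall n \near \oo, forall P, PP P ->
    'EE_P (fun w => phi (partial_sum X n w / n%:R)) <= M + e.
Proof.
move=> phiP phiM e0; have /Cb_LipP[B [L [L0 bB lL]]] := phiP.
have B0 : 0 <= B by rewrite (le_trans _ (bB 0)).
(* The final bound is [M + (2 B + 8 L) e1]; the summand 1 keeps the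
   denominator positive. *)
pose e1 := e / (2 * B + 8 * L + 1).
have den0 : 0 < 2 * B + 8 * L + 1 by rewrite ltr_wpDl// addr_ge0// mulr_ge0.
have e10 : 0 < e1 by exact: divr_gt0.
have e1e : (2 * B + 8 * L) * e1 <= e.
  rewrite /e1 mulrA ler_pdivrMr// [leRHS]mulrC ler_pM2r//.
  by rewrite lerDl.
have s_small : \forall n \near \oo, s n / n%:R <= e1 * e1 / 4.
  have e40 : 0 < e1 * e1 / 4 by rewrite divr_gt0// mulr_gt0.
  have /cvgrPdist_le/(_ _ e40) := second_moment_average_cvg0 nv0.
  apply: filterS => n.
  by rewrite sub0r normrN; apply: le_trans (ler_norm _).
have nv_small : \forall n \near \oo, n%:R * v n <= e1.
  have /cvgrPdist_le/(_ e1 e10) := nv0; apply: filterS => n.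
  by rewrite sub0r normrN; apply: le_trans (ler_norm _).
near=> n => P PPP.
have n_gt0 : (0 < n)%N by near: n; exact: nbhs_infty_gt.
have nR0 : 0 < n%:R :> R by rewrite ltr0n.
have sn : s n / n%:R <= e1 * e1 / 4 by near: n.
have nvn : n%:R * v n <= e1 by near: n.
have up : n%:R^-1 * \sum_(i < n) rsup (truncated X n i) <= mu_up + e1.
  by near: n; exact: mean_up.
have low : n%:R^-1 * \sum_(i < n) rsup (\- truncated X n i) <= - mu_low + e1.
  by near: n; exact: mean_low.
pose c i w := clamp n (X i w).
pose U := \sum_(i < n) rsup (clamp n \o X i).
pose U' := \sum_(i < n) rsup ((fun x => - clamp n x) \o X i).
have Ule : U / n%:R <= mu_up + 2 * e1.
  apply: (le_trans (average_leD n_gt0 (clamped_mean_le n))).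
  by rewrite [2 * e1]mulr_natl mulr2n addrA lerD.
have U'le : U' / n%:R <= - mu_low + 2 * e1.
  apply: (le_trans (average_leD n_gt0 (clamped_meanN_le n))).
  by rewrite [2 * e1]mulr_natl mulr2n addrA lerD.
have excess_small : e1 + 4 * (s n / n%:R) / e1 <= 2 * e1.
  by rewrite [2 * e1]mulr_natl mulr2n lerD2l ler_pdivrMr//; move: sn; lra.
pose Dp w := Num.max (\sum_(i < n) (c i w - rsup (clamp n \o X i))) 0 / n%:R.
pose Dm w := Num.max (\sum_(i < n)
  (- c i w - rsup ((fun x => - clamp n x) \o X i))) 0 / n%:R.
have EDp : 'EE_P Dp <= 2 * e1.
  apply: le_trans excess_small.
  exact: (mean_excess_le PPP (Cb_Lip_clamp R n) (fun=> erefl) n_gt0 e10).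
have EDm : 'EE_P Dm <= 2 * e1.
  apply: le_trans excess_small.
  apply: (mean_excess_le PPP (Cb_LipN (Cb_Lip_clamp R n)) _ n_gt0 e10).
  by move=> x; rewrite sqrrN.
have bc i : bounded_rv (c i) by exact: bounded_clamp.
have bDp : bounded_rv Dp.
  apply: bounded_rvM (bounded_rv_cst _ _); apply: bounded_rv_pos.
  apply: (@bounded_rv_sum _ _ _ _ (fun i w => c i w - rsup (clamp n \o X i))).
  by move=> i; exact: bounded_rvB (bounded_rv_cst _ _).
have bDm : bounded_rv Dm.
  apply: bounded_rvM (bounded_rv_cst _ _); apply: bounded_rv_pos.
  apply: (@bounded_rv_sum _ _ _ _
    (fun i w => - c i w - rsup ((fun x => - clamp n x) \o X i))).
  by move=> i; apply: bounded_rvB (bounded_rv_cst _ _); exact: bounded_rvN.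
pose N w := \sum_(i < n) (\1_(tail i n) w : R).
have bN : bounded_rv N.
  exact: (@bounded_rv_sum _ _ _ _ (fun i => \1_(tail i n))).
have EN : 'EE_P N <= e1.
  rewrite /N (@Rintegral_sumT _ _ _ _ _ (fun i => \1_(tail i n)))//.
  apply: le_trans nvn.
  rewrite [leRHS]mulr_natl -[X in _ *+ X]card_ord -sumr_const.
  by apply: ler_sum => i _; exact: E_tail_le.
have pointwise w : phi (partial_sum X n w / n%:R) <=
    M + 4 * L * e1 + (2 * B * N w + L * (Dp w + Dm w)).
  have Dp0 : 0 <= Dp w by rewrite divr_ge0// le_max lexx orbT.
  have Dm0 : 0 <= Dm w by rewrite divr_ge0// le_max lexx orbT.
  have N0 : 0 <= N w by apply: sumr_ge0 => i _; rewrite tailE.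
  (* If some variable exceeds the level, then [N w >= 1], and [phi <= B] while
     [M >= phi mu_low >= - B]. *)
  have [[i Xi]|noX] := pselect (exists i : 'I_n, n%:R <= `|X i w|).
    have N1 : 1 <= N w.
      rewrite /N (bigD1 i)//= tailE Xi lerDl.
      by apply: sumr_ge0 => j _; rewrite tailE.
    have MB : - B <= M.
      apply: (@le_trans _ _ (phi mu_low)); last first.
        by apply: phiM; rewrite lexx mean_low_le_up.
      by have := bB mu_low; rewrite ler_norml => /andP[].
    have phiB : phi (partial_sum X n w / n%:R) <= B.
      exact: le_trans (ler_norm _) (bB _).
    have BN : 2 * B <= 2 * B * N w by rewrite ler_peMr// mulr_ge0.
    have LD : 0 <= L * (Dp w + Dm w) by rewrite mulr_ge0// addr_ge0.
    have Le : 0 <= 4 * L * e1 by apply: mulr_ge0; [exact: mulr_ge0|exact: ltW].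
    move: phiB MB BN LD Le; lra.
  have -> : partial_sum X n w = \sum_(i < n) c i w.
    apply: eq_bigr => i _; rewrite /c clamp_id// ltNge.
    by apply/negP => Xi; apply: noX; exists i.
  have BN : 0 <= 2 * B * N w by rewrite !mulr_ge0.
  rewrite (@le_trans _ _
    (M + L * ((2 * e1 + Dp w) + (2 * e1 + Dm w))))//; last first.
    by move: BN; lra.
  have e20 : 0 <= 2 * e1 by apply: mulr_ge0 => //; exact: ltW.
  apply: (lipschitz_le_near_interval mean_low_le_up phiM L0 lL).
  - exact: addr_ge0.
  - exact: addr_ge0.
  - rewrite addrA (le_trans _ (lerD Ule (lexx _)))//.
    rewrite -mulrDl ler_pM2r ?invr_gt0// addrC -lerBlDr.
    by rewrite /U -sumrB le_max lexx.
  - rewrite opprD addrA -lerN2 !opprD !opprK.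
    rewrite (le_trans _ (lerD U'le (lexx _)))//.
    rewrite -mulNr -mulrDl ler_pM2r ?invr_gt0// addrC -lerBlDr.
    by rewrite /U' -sumrN -sumrB le_max lexx.
have bS : bounded_rv (fun w => phi (partial_sum X n w / n%:R)).
  apply: (bounded_rv_Cb_Lip phiP (f := fun w => partial_sum X n w / n%:R)).
  by apply: measurable_funM => //; apply: measurable_sum.
have bDD : bounded_rv (fun w => Dp w + Dm w) by exact: bounded_rvD.
have bLD : bounded_rv (fun w => L * (Dp w + Dm w)).
  exact: bounded_rvM (bounded_rv_cst _ _) bDD.
have bBN : bounded_rv (fun w => 2 * B * N w).
  exact: bounded_rvM (bounded_rv_cst _ _) bN.
have bcst : bounded_rv (fun _ : T => M + 4 * L * e1) by exact: bounded_rv_cst.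
have bG := bounded_rvD bcst (bounded_rvD bBN bLD).
apply: (le_trans (le_RintegralT P bS bG pointwise)).
rewrite (RintegralDT P bcst (bounded_rvD bBN bLD)) (RintegralDT P bBN bLD).
rewrite Rintegral_cstT !RintegralZT// RintegralDT//.
have : 2 * B * 'EE_P N <= 2 * B * e1 by rewrite ler_wpM2l// mulr_ge0.
have : L * ('EE_P Dp + 'EE_P Dm) <= L * (4 * e1).
  by apply: ler_wpM2l => //; move: EDp EDm; lra.
move: e1e; lra.
Unshelve. all: by end_near. Qed.

End law_of_large_numbers.

Theorem theorem4p1 (R : realType) (Omega : completeMetricType R)
    (sepOmega : separable Omega)
    (PP : set (probability (borelType Omega) R)) (PP0 : PP !=set0)
    (X : nat -> {mfun borelType Omega >-> R})
    (indX : pseudo_independent PP X)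
    (Y : {mfun borelType Omega >-> R})
    (tailY : (n%:R%:E * upper_probability PP [set w | (n%:R <= `|Y w|)%R])%E
               @[n --> \oo] --> 0%E)
    (K : R)
    (domX : forall (n : nat) (x : R), 0 <= x ->
       (upper_probability PP [set w | (x <= `|X n w|)%R] <=
        K%:E * upper_probability PP [set w | (x <= `|Y w|)%R])%E)
    (mu_low mu_up : R)
    (mu_upE : upper_mean PP X = mu_up%:E)
    (mu_lowE : lower_mean PP X = mu_low%:E)
    (phi : R -> R) (phiP : Cb_Lip phi) :
  let E n :=
    sublinear_expectation PP (fun w => phi (partial_sum X n w / n%:R)) in
  exists m M : R,
    [/\ is_min (phi @` `[mu_low, mu_up]) m,
        is_max (phi @` `[mu_low, mu_up]) M,
        (m%:E <= limn_einf E)%E,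
        (limn_einf E <= limn_esup E)%E &
        (limn_esup E <= M%:E)%E].
Proof.
move=> E.
pose trunc n := n%:R^-1 * \sum_(i < n) rsup_expectation PP (truncated X n i).
pose truncN n := n%:R^-1 * \sum_(i < n) rsup_expectation PP (\- truncated X n i).
pose v k := K * rupper_probability PP [set w | k%:R <= `|Y w|].
have tail_le i k : rupper_probability PP [set w | k%:R <= `|X i w|] <= v k.
  have := domX i _ (ler0n R k).
  by rewrite !(upper_probabilityE PP0) ?lee_fin//; exact: measurable_normr_ge.
have nv0 : (fun n : nat => n%:R * v n) @ \oo --> (0 : R).
  rewrite (_ : (fun n => _) = fun n =>
      K * (n%:R * rupper_probability PP [set w | n%:R <= `|Y w|])); last first.
    by apply/funext => n; rewrite mulrCA.
  rewrite -[0](mulr0 K); apply: cvgMr.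
  have /fine_cvgP[_ tY] := tailY.
  apply: cvg_trans tY; apply: near_eq_cvg; apply: nearW => n /=.
  by rewrite (upper_probabilityE PP0)//; exact: measurable_normr_ge.
have mean_up (e : R) : 0 < e -> \forall n \near \oo, trunc n <= mu_up + e.
  move=> e0; have : (upper_mean PP X < (mu_up + e)%:E)%E.
    by rewrite mu_upE lte_fin ltrDl.
  move=> /limn_esup_near; apply: filterS => n; rewrite -lee_fin => /ltW.
  under eq_bigr do rewrite (sublinear_expectationE PP0 (bounded_truncated X _ _)).
  by rewrite sumEFin -EFinM.
have mean_low (e : R) : 0 < e -> \forall n \near \oo, truncN n <= - mu_low + e.
  move=> e0; have : (- lower_mean PP X < (- mu_low + e)%:E)%E.
    by rewrite mu_lowE -EFinN lte_fin ltrDl.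
  rewrite /lower_mean /limn_einf oppeK => /limn_esup_near.
  apply: filterS => n; rewrite -lee_fin => /ltW /=.
  under eq_bigr do rewrite (sublinear_expectationE PP0
    (bounded_rvN (bounded_truncated X _ _))) -EFinN.
  by rewrite sumEFin -EFinM -EFinN sumrN mulrN opprK.
have low_up : mu_low <= mu_up.
  exact: (mean_low_le_up PP0 mean_up mean_low).
have cphi : {within `[mu_low, mu_up], continuous phi}.
  apply: continuous_subspaceT; exact: Cb_Lip_continuous.
have [xM xMi xMmax] := EVT_max low_up cphi.
have [xm xmi xmmin] := EVT_min low_up cphi.
have bphi n : bounded_rv (fun w => phi (partial_sum X n w / n%:R)).
  apply: (bounded_rv_Cb_Lip phiP (f := fun w => partial_sum X n w / n%:R)).
  by apply: measurable_funM => //; apply: measurable_sum.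
exists (phi xm), (phi xM); split.
- split; first by exists xm.
  by move=> _ [x /= xi <-]; exact: xmmin.
- split; first by exists xM.
  by move=> _ [x /= xi <-]; exact: xMmax.
(* Any single probability bounds an upper expectation from below. *)
- rewrite /limn_einf leeNr -EFinN; apply: limn_esup_le_near => e e0.
  have : \forall n \near \oo, forall P, PP P -> Rintegral P setT
      (fun w => - phi (partial_sum X n w / n%:R)) <= - phi xm + e.
    apply: (expectation_mean_le PP0 indX tail_le nv0 mean_up mean_low
      (Cb_LipN phiP)) => //.
    by move=> x xi; rewrite lerN2 xmmin// in_itv.
  apply: filterS => n En; have [P PPP] := PP0.
  rewrite leeNl -EFinN /E (sublinear_expectationE PP0 (bphi n)) lee_fin.
  apply: le_trans (rsup_expectation_ge PP0 (bphi n) PPP).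
  by rewrite lerNl -RintegralNT//; exact: En.
- exact: limn_einf_sup.
- apply: limn_esup_le_near => e e0.
  have := expectation_mean_le PP0 indX tail_le nv0 mean_up mean_low phiP
    (M := phi xM) _ e0.
  move=> /(_ _)[]; first by move=> x xi; rewrite xMmax// in_itv.
  move=> N _ hN; exists N => // n Nn.
  by apply: sublinear_expectation_le => // P PPP; exact: hN.
Qed.
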